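(* Let $r\geq3$ be odd and $n\geq\frac{r+3}{2}$. If $r\geq7$, then $\det(1;T_{r+2}^{(r)},T_{r+4}^{(r)},\ldots,T_{2n+r}^{(r)})$ equals \begin{itemize} \item $(-1)^{n-q}$ if $n=q(r-1)/2$ for some integer $q$; \item $2\cdot(-1)^{n-1-q}$ if $n-1=q(r-1)/2$ for some integer $q$; \item $(-1)^{n-q}$ if $n-2=q(r-1)/2$ for some integer $q$; \item $0$ otherwise. \end{itemize} If $r=5$, then $\det(1;T_7^{(5)},T_9^{(5)},\ldots,T_{2n+5}^{(5)})$ equals $0$ if $n$ is even and $2\cdot(-1)^{(n-1)/2}$ if $n$ is odd. If $r=3$, then $\det(1;T_5,T_7,\ldots,T_{2n+3})=4$ for all $n\geq3$.
   Context: For $r\ge3$, the generalized $r$-tribonacci numbers are defined by $T_0^{(r)}=\cdots=T_{r-2}^{(r)}=0$, $T_{r-1}^{(r)}=1$, and $T_n^{(r)}=T_{n-1}^{(r)}+T_{n-2}^{(r)}+T_{n-r}^{(r)}$ for $n\geq r$; $T_n=T_n^{(3)}$ are the ordinary tribonacci numbers. For numbers $a_0,\ldots,a_n$, $\det(a_0;a_1,\ldots,a_n)$ denotes the determinant of the $n\times n$ Toeplitz--Hessenberg matrix whose $(i,j)$ entry is $a_{i-j+1}$ if $i-j+1\ge0$ and $0$ otherwise; here the $k$-th entry after the semicolon is $T_{r+2k}^{(r)}$. *)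

(* Defs.v *)
From mathcomp Require Import all_boot all_order all_algebra.
Set Implicit Arguments.
Unset Strict Implicit.
Unset Printing Implicit Defensive.
Import Order.TTheory GRing.Theory Num.Theory.

(* The numbers T_n^(r) are produced by extending the reversed history
   [:: T_(n-1); ...; T_0], so T_(n-k) is the item k.-1 of that history.
   The lemmas gtrib_small, gtrib_one and gtrib_rec below are the usual
   initial conditions and recurrence. *)
Definition gtrib_next (r : nat) (s : seq nat) : nat :=
  if size s < r.-1 then 0
  else if size s == r.-1 then 1
  else nth 0 s 0 + nth 0 s 1 + nth 0 s r.-1.

Definition gtrib_hist (r n : nat) : seq nat :=
  iter n (fun s => gtrib_next r s :: s) [::].

Definition gtrib (r n : nat) : nat := gtrib_next r (gtrib_hist r n).

Lemma size_gtrib_hist r n : size (gtrib_hist r n) = n.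
Proof. by elim: n => //= n ->. Qed.

Lemma nth_gtrib_hist r n k :
  k < n -> nth 0 (gtrib_hist r n) k = gtrib r (n - k.+1).
Proof.
elim: n k => //= n IHn [_|k]; first by rewrite subSS subn0.
by rewrite ltnS subSS /=; apply: IHn.
Qed.

Lemma gtrib_small r n : n < r.-1 -> gtrib r n = 0.
Proof. by move=> lt_nr; rewrite /gtrib /gtrib_next size_gtrib_hist lt_nr. Qed.

Lemma gtrib_one r : gtrib r r.-1 = 1.
Proof. by rewrite /gtrib /gtrib_next size_gtrib_hist ltnn eqxx. Qed.

Lemma gtrib_rec r n : 3 <= r -> r <= n ->
  gtrib r n = gtrib r (n - 1) + gtrib r (n - 2) + gtrib r (n - r).
Proof.
move=> r_ge3 le_rn; have r_gt0 : 0 < r by apply: leq_trans r_ge3.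
have lt_rn : r.-1 < n by rewrite prednK.
have n_ge3 : 2 < n by apply: leq_trans le_rn.
rewrite {1}/gtrib /gtrib_next size_gtrib_hist ltnNge (ltnW lt_rn) /=.
rewrite gtn_eqF // !nth_gtrib_hist ?prednK //.
  by apply: ltnW.
by apply: leq_trans n_ge3.
Qed.

Local Open Scope ring_scope.

(* The matrix of det(a0; a 1, ..., a n); the value a 0 is not used.  Indices
   start at 0 here, which leaves i - j + 1 unchanged; the test j <= i + 1
   keeps the natural subtraction exact. *)
Definition toeplitz_hessenberg (R : pzRingType) (n : nat) (a0 : R)
    (a : nat -> R) : 'M[R]_n :=
  \matrix_(i < n, j < n)
    if (j <= i.+1)%N then
      let k := (i.+1 - j)%N in if k == 0%N then a0 else a k
    else 0.

Definition det_th (R : comPzRingType) (n : nat) (a0 : R) (a : nat -> R) : R :=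
  \det (toeplitz_hessenberg n a0 a).

(* Main.v *)
(* Put r = 2m+1, P = 1-z, Q = 1+z^m, and let S and E be the generating series
   in z of T_(r+2k) and T_(r-1+2k).  The recurrence, split by parity, reads
   P S = Q E and P E = 1 + z Q S, so that S (P^2 - z Q^2) = Q and
   1/S = P^2/Q - z Q.  By Cramer's rule for the lower triangular Toeplitz matrix
   of S, the determinant is (-1)^n times the coefficient of z^n in 1/S, to which
   z Q does not contribute when n >= m+2. *)
Require Import Defs.
From mathcomp Require Import all_boot all_order all_algebra.
From mathcomp Require Import ring zify.
Set Implicit Arguments.
Unset Strict Implicit.
Unset Printing Implicit Defensive.
Import Order.TTheory GRing.Theory Num.Theory.
Local Open Scope ring_scope.

(** The hypothesis on [b] is the system [L *m v = e_0] with [L] lower unitriangular, so [v] is the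
    first column of [\adj L]. Its last entry is a cofactor of sign [(-1) ^+ n]. *)
Lemma det_th_inverse (R : comPzRingType) (n : nat) (a b : nat -> R) :
  a 0%N = 1 ->
  (forall i, (i <= n)%N -> \sum_(j < i.+1) a (i - j)%N * b j = (i == 0%N)%:R) ->
  det_th n 1 a = (-1) ^+ n * b n.
Proof.
move=> a0 ab.
pose L : 'M[R]_n.+1 :=
  \matrix_(i, j) if (j <= i)%N then a (i - j)%N else 0.
pose v : 'cV[R]_n.+1 := \col_j b j.
have detL : \det L = 1.
  rewrite det_trig; first by rewrite big1 // => i _; rewrite mxE leqnn subnn.
  by apply/is_trig_mxP => i j lt_ij; rewrite mxE leqNgt lt_ij.
have Lv : L *m v = delta_mx 0 0.
  apply/matrixP => i k; rewrite !mxE ord1 eqxx andbT -val_eqE /=.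
  rewrite -(ab i); last by rewrite -ltnS.
  rewrite (big_ord_widen n.+1 (fun j => a (i - j)%N * b j)) // [RHS]big_mkcond.
  by apply: eq_bigr => j _; rewrite !mxE ltnS; case: ifP => // _; rewrite mul0r.
have /matrixP/(_ ord_max 0) : v = \adj L *m delta_mx 0 0.
  by rewrite -Lv mulmxA mul_adj_mx detL mul1mx.
rewrite -colE !mxE /cofactor /= add0n => ->.
rewrite mulrA -exprD addnn -mul2n exprM sqrrN !expr1n mul1r.
(* Deleting row 0 and the last column of [L] shifts only the row index, which gives the Hessenberg
   pattern [a (i.+1 - j)]. *)
congr (\det _); apply/matrixP => i j; rewrite !mxE /= /bump leq0n (leqNgt n).
rewrite ltn_ord add0n add1n.
by case: leqP => // le_ji; case: eqP => // ->; rewrite a0.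
Qed.

(** Series are handled through truncations; an explicit multiple of ['X^N] turns each congruence
    into an equation usable by [ring]. *)
Lemma poly_eq_mod_Xn (R : nzRingType) (N : nat) (p q : {poly R}) :
  (forall k, (k < N)%N -> p`_k = q`_k) -> exists h, p = q + h * 'X^N.
Proof.
move=> pq; exists (drop_poly N p - drop_poly N q).
have pq_take : take_poly N p = take_poly N q.
  by apply/polyP => k; rewrite !coef_take_poly; case: ifP => // /pq.
rewrite mulrBl -[LHS](poly_take_drop N) -[X in _ = X + _](poly_take_drop N q).
by rewrite pq_take -addrA [_ * _ + (_ - _)]addrC subrK.
Qed.

(** For positive [m], these are the coefficients of the series [1 / (1 + z^m)]. *)
Definition alt_geom (m k : nat) : int :=
  if (m %| k)%N then (-1) ^+ (k %/ m) else 0.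

Lemma alt_geom0 m : alt_geom m 0 = 1.
Proof. by rewrite /alt_geom dvdn0 div0n. Qed.

Lemma alt_geomD m k : (0 < m)%N -> alt_geom m (k + m) = - alt_geom m k.
Proof.
move=> m_gt0; rewrite /alt_geom dvdn_addl // divnDr // divnn m_gt0 addn1.
by rewrite exprS mulN1r; case: ifP => // _; rewrite oppr0.
Qed.

Lemma alt_geom_small m k : (0 < k < m)%N -> alt_geom m k = 0.
Proof. by case/andP=> k_gt0 ltkm; rewrite /alt_geom gtnNdvd. Qed.

Section EvenOddSeries.

Variables m N : nat.
Hypothesis m_gt0 : (0 < m)%N.

Let r := (2 * m).+1.
(** [C] stands for the truncation of [1 / Q]. *)
Let S : {poly int} := \poly_(k < N) (gtrib r (r + 2 * k))%:Z.
Let E : {poly int} := \poly_(k < N) (gtrib r (2 * m + 2 * k))%:Z.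
Let C : {poly int} := \poly_(k < N) alt_geom m k.
Let P : {poly int} := 1 - 'X.
Let Q : {poly int} := 1 + 'X^m.

Lemma odd_part_rec : exists h, P * S = Q * E + h * 'X^N.
Proof.
apply: poly_eq_mod_Xn => k ltkN.
rewrite /P /Q mulrBl mulrDl !mul1r coefB coefD coefXM coefXnM !coef_poly ltkN.
have rec : gtrib r (r + 2 * k) =
    (gtrib r (2 * m + 2 * k) + gtrib r (r + 2 * k - 2) + gtrib r (2 * k))%N.
  rewrite gtrib_rec; [|rewrite /r; lia..].
  by congr (gtrib _ _ + gtrib _ _ + gtrib _ _)%N; rewrite /r; lia.
(* The term ['X^m * E] accounts for [T_(2k)]: below degree [m] it has no coefficient, in agreement
   with the zero initial values. *)
have e_delay : (if (k < m)%N then 0 else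
    if (k - m < N)%N then (gtrib r (2 * m + 2 * (k - m)))%:Z else 0) =
    (gtrib r (2 * k))%:Z.
  case: ltnP => [ltkm|lemk]; first by rewrite gtrib_small // /r; lia.
  by rewrite ifT; [congr (gtrib _ _)%:Z|]; lia.
rewrite e_delay rec; case: k => [|k] in ltkN rec e_delay * => /=.
  have -> : gtrib r (r + 2 * 0 - 2) = 0%N by rewrite gtrib_small // /r; lia.
  lia.
have -> : (r + 2 * k.+1 - 2 = r + 2 * k)%N by lia.
rewrite ltnW //; lia.
Qed.

Lemma even_part_rec : exists h, P * E = 1 + 'X * Q * S + h * 'X^N.
Proof.
apply: poly_eq_mod_Xn => k ltkN.
rewrite /P /Q mulrBl mul1r -mulrA mulrDl mul1r.
rewrite coefB coefD !coefXM coefD coefXnM coef1 !coef_poly ltkN.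
case: k => [|k] in ltkN * => /=.
  (* The constant 1 is the initial value [T_(r-1)], which the recurrence does not produce. *)
  by rewrite muln0 addn0 (gtrib_one r).
rewrite ltnW //.
have -> : gtrib r (2 * m + 2 * k.+1) =
    (gtrib r (r + 2 * k) + gtrib r (2 * m + 2 * k) + gtrib r (2 * k).+1)%N.
  rewrite gtrib_rec; [|rewrite /r; lia..].
  by congr (gtrib _ _ + gtrib _ _ + gtrib _ _)%N; rewrite /r; lia.
have -> : (if (k < m)%N then 0 else
    if (k - m < N)%N then (gtrib r (r + 2 * (k - m)))%:Z else 0) =
    (gtrib r (2 * k).+1)%:Z.
  case: ltnP => [ltkm|lemk]; first by rewrite gtrib_small // /r; lia.
  by rewrite ifT; [congr (gtrib _ _)%:Z|]; rewrite /r; lia.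
lia.
Qed.

Lemma alt_geom_series : exists h, Q * C = 1 + h * 'X^N.
Proof.
apply: poly_eq_mod_Xn => k ltkN.
rewrite /Q mulrDl mul1r coefD coefXnM coef1 !coef_poly ltkN.
case: ltnP => [ltkm|lemk].
  rewrite addr0; case: k => [|k] in ltkN ltkm *; first by rewrite alt_geom0.
  by rewrite alt_geom_small.
rewrite ifT; last lia.
rewrite -{1}(subnK lemk) alt_geomD // addNr.
by case: k => // in ltkN lemk *; lia.
Qed.

Lemma odd_part_inverse : exists h, S * (P ^+ 2 * C - 'X * Q) = 1 + h * 'X^N.
Proof.
have [h1 PS] := odd_part_rec; have [h2 PE] := even_part_rec.
have [h3 QC] := alt_geom_series.
(* The middle summand is the error of the two recurrences; the outer two come from replacing [Q * C]
   by 1 twice. *)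
exists (h3 + C * (Q * h2 + P * h1) + S * 'X * Q * h3).
(* [E] is eliminated between the two recurrences. *)
have PPS : P ^+ 2 * S = Q + 'X * Q ^+ 2 * S + (Q * h2 + P * h1) * 'X^N.
  by rewrite expr2 -mulrA PS mulrDr mulrCA PE; ring.
transitivity (P ^+ 2 * S * C - S * 'X * Q); first by ring.
rewrite PPS.
transitivity (Q * C + 'X * Q * S * (Q * C) +
  (Q * h2 + P * h1) * 'X^N * C - S * 'X * Q); first by ring.
by rewrite QC; ring.
Qed.

(** Since ['X * Q] has degree [m.+1], only [(1 - 2z + z^2) * C] reaches degree [n]. *)
Lemma coef_inverse n : (m.+2 <= n)%N -> (n < N)%N ->
  (P ^+ 2 * C - 'X * Q)`_n =
  alt_geom m n - 2 * alt_geom m (n - 1) + alt_geom m (n - 2).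
Proof.
move=> le_mn ltnN.
have -> : P ^+ 2 * C - 'X * Q =
    C - ('X * C) *+ 2 + 'X^2 * C - 'X - 'X^(m.+1).
  by rewrite /P /Q (exprS _ m); ring.
rewrite !(coefMn, coefB, coefD) coefXM !coefXnM coefX coefXn !coef_poly.
rewrite -subn1 ltnN !(leq_ltn_trans (leq_subr _ _) ltnN).
have neq k : (k <= m.+1)%N -> (n == k) = false by lia.
by rewrite !neq // ltnNge (leq_trans _ le_mn) // !subr0 mulr_natl.
Qed.

End EvenOddSeries.

Lemma det_gtrib m n : (0 < m)%N -> (m.+2 <= n)%N ->
  det_th n 1 (fun k : nat =>
    (gtrib (2 * m).+1 ((2 * m).+1 + 2 * k))%:Z : int) =
  (-1) ^+ n * (alt_geom m n - 2 * alt_geom m (n - 1) + alt_geom m (n - 2)).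
Proof.
move=> m_gt0 le_mn; rewrite -(coef_inverse m_gt0 le_mn (ltnSn n)).
have [h] := odd_part_inverse n.+1 m_gt0.
set B := (X in _ * X = _) => Sinv.
apply: (det_th_inverse (b := fun j => B`_j)) => [|i le_in].
  (* [T_r = T_(r-1) + T_(r-2) + T_0 = 1] agrees with the superdiagonal entry 1. *)
  rewrite muln0 addn0 gtrib_rec; [|lia..].
  by rewrite subnn subn1 /= (gtrib_one (2 * m).+1) !gtrib_small //=; lia.
have := congr1 (fun p : {poly int} => p`_i) Sinv.
rewrite /= coefD coefMXn ltnS le_in addr0 coef1 => <-.
rewrite coefMr; apply: eq_bigr => j _; congr (_ * _).
by rewrite coef_poly ifT //; lia.
Qed.

Lemma alt_geomM m q : (0 < m)%N -> alt_geom m (q * m) = (-1) ^+ q.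
Proof. by move=> m_gt0; rewrite /alt_geom dvdn_mull // mulnK. Qed.

Lemma alt_geom_off m q k : (q * m < k < q.+1 * m)%N -> alt_geom m k = 0.
Proof.
move=> /andP[lt_k gt_k]; rewrite /alt_geom; case: ifP => // /dvdnP[p def_k].
by move: lt_k gt_k; rewrite def_k !ltn_mul2r => /andP[_ ?] /andP[_ ?]; lia.
Qed.

Lemma sign_subz (n k : nat) : (k <= n)%N ->
  (-1) ^ (n%:Z - k%:Z) = (-1) ^+ n * (-1) ^+ k :> int.
Proof.
move=> le_kn; rewrite subzn // -exprnP -[in RHS](subnK le_kn) exprD -mulrA.
by rewrite -exprMn mulrNN mulr1 expr1n mulr1.
Qed.

(** A negative [q] would make the product nonpositive. This reduces the integer quotients of the
    theorem to natural ones. *)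
Lemma nat_quotient (p n : nat) (q : int) : (0 < n)%N ->
  n%:Z = q * p%:Z -> exists2 k : nat, q = k%:Z & n = (k * p)%N.
Proof.
move=> n_gt0; case: q => k def_n; last by nia.
by exists k => //; apply/eqP; rewrite -eqz_nat PoszM def_n.
Qed.

Theorem theorem9 (r n : nat) (r_ge3 : (3 <= r)%N) (r_odd : odd r)
    (n_ge : ((r + 3) %/ 2 <= n)%N) :
  let D : int := det_th n 1 (fun k : nat => (gtrib r (r + 2 * k))%:Z) in
  let m : int := ((r - 1) %/ 2)%N%:Z in
  [/\ (7 <= r)%N ->
      [/\ forall q : int, n%:Z = q * m -> D = (-1) ^ (n%:Z - q),
          forall q : int, n%:Z - 1 = q * m -> D = 2 * (-1) ^ (n%:Z - 1 - q),
          forall q : int, n%:Z - 2 = q * m -> D = (-1) ^ (n%:Z - q)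
        & (forall q : int,
             [/\ n%:Z <> q * m, n%:Z - 1 <> q * m & n%:Z - 2 <> q * m]) ->
          D = 0],
      r = 5%N -> D = (if odd n then 2 * (-1) ^+ ((n - 1) %/ 2) else 0)
    & r = 3%N -> D = 4].
Proof.
have [p def_r] : exists p, r = (2 * p).+1 by exists r./2; lia.
subst r => D m.
have p_gt0 : (0 < p)%N by lia.
have le_pn : (p.+2 <= n)%N by lia.
have def_m : m = p%:Z by rewrite /m; congr Posz; lia.
have DE : D = (-1) ^+ n *
  (alt_geom p n - 2 * alt_geom p (n - 1) + alt_geom p (n - 2)).
  exact: det_gtrib.
clearbody D m; subst m; split.
(* Multiples of [p] are now at least 3 apart, so at most one of [n], [n - 1], [n - 2] is a multiple
   and at most one term survives. *)
- move=> r_ge7; have p_ge3 : (2 < p)%N by lia.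
  split.
  + move=> q /nat_quotient[|k -> def_n]; first lia.
    have k_gt0 : (0 < k)%N by nia.
    rewrite DE sign_subz; last nia.
    rewrite [X in alt_geom _ X]def_n alt_geomM //.
    rewrite !(alt_geom_off (q := k.-1)); [ring | nia | nia].
  + rewrite subzn; last lia.
    move=> q /nat_quotient[|k -> def_n]; first lia.
    have k_gt0 : (0 < k)%N by nia.
    rewrite DE sign_subz; last nia.
    rewrite def_n alt_geomM // -def_n (alt_geom_off (q := k)); last nia.
    rewrite (alt_geom_off (q := k.-1)); last nia.
    rewrite -[in LHS](@subnK 1 n) ?addn1 ?exprS; last lia.
    by ring.
  + rewrite subzn; last lia.
    move=> q /nat_quotient[|k -> def_n]; first lia.
    have k_gt0 : (0 < k)%N by nia.
    rewrite DE sign_subz; last nia.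
    rewrite def_n alt_geomM // !(alt_geom_off (q := k)); [ring | nia | nia].
  + move=> off; rewrite DE /alt_geom !ifF ?mulr0 ?subr0 ?addr0 ?mulr0 //.
    * apply/negP => /dvdnP[k def_n]; have [_ _] := off k%:Z; lia.
    * apply/negP => /dvdnP[k def_n]; have [_ + _] := off k%:Z; lia.
    * apply/negP => /dvdnP[k def_n]; have [+ _ _] := off k%:Z; lia.
(* For [p = 2], odd [n] leaves only the middle term, while for even [n] the outer terms cancel by
   [alt_geomD]. *)
- move=> r5; have {r5} p2 : p = 2 by lia.
  subst p; rewrite DE; have := odd_double_half n.
  case: (odd n) => def_n.
    have -> : alt_geom 2 n = 0 by apply: (alt_geom_off (q := n./2)); lia.
    have -> : alt_geom 2 (n - 2) = 0.
      by apply: (alt_geom_off (q := (n./2).-1)); lia.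
    have def_n1 : (n - 1 = n./2 * 2)%N by lia.
    rewrite def_n1 alt_geomM // mulnK // -signr_odd.
    have -> : odd n by lia.
    by ring.
  have -> : alt_geom 2 (n - 1) = 0.
    by apply: (alt_geom_off (q := (n./2).-1)); lia.
  rewrite -[X in alt_geom _ X](@subnK 2 n) ?alt_geomD //; last lia.
  by ring.
(* For [p = 1] every term survives and all three have the same sign, so the sum is [1 + 2 + 1] up to
   that sign. *)
- move=> r3; have {r3} p1 : p = 1%N by lia.
  subst p; rewrite DE /alt_geom !dvd1n !divn1.
  have [k ->] : exists k, n = k.+2 by exists (n - 2)%N; lia.
  rewrite subn1 subn2 /= !exprS.
  transitivity (4 * ((-1) ^+ k * (-1) ^+ k) : int); first by ring.
  by rewrite -exprMn mulrNN mulr1 expr1n.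
Qed.
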